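(* Let $d : p \to_{\beta_f}^* q$ be a normalising evaluation in the split fireball calculus ($q$ normal). Then there is a tight type derivation $\pi \triangleright \Gamma \vdash p : \mathbf 0$ with $|\pi| = |d| + |q| = |d| + |\Gamma|$. In particular, if $q$ is a coerced value, then $|\pi| = |d|$ and $\mathrm{dom}(\Gamma) = \emptyset$.
   Context: Terms: $t,u ::= x \mid \lambda x.t \mid tu$, up to $\alpha$-equivalence; $t\{x\leftarrow u\}$ is capture-avoiding substitution. Values: $v ::= x \mid \lambda x.t$. Fireballs $f$ and inert terms $i$ are defined by mutual induction: $f ::= v \mid i$ and $i ::= x f_1 \dots f_n$ with $n>0$ (application left-associative). Right evaluation contexts: $C ::= \langle\cdot\rangle \mid t\,C \mid C\,f$. Split fireball calculus: environments $E ::= \epsilon \mid [x\leftarrow i]:E$; programs are pairs $p=(t,E)$; a coerced value is a program $(v,\epsilon)$. Reduction: $(C\langle(\lambda x.t)v\rangle,E)\to_{\beta_v}(C\langle t\{x\leftarrow v\}\rangle,E)$ and $(C\langle(\lambda x.t)i\rangle,E)\to_{\beta_i}(C\langle t\rangle,[x\leftarrow i]:E)$; $\to_{\beta_f}=\to_{\beta_v}\cup\to_{\beta_i}$. A program is normal if it has no $\to_{\beta_f}$-reduct. $|d|$ is the number of steps of $d$. Append: $\epsilon@[x\leftarrow i]=[x\leftarrow i]$, $([y\leftarrow i']:E)@[x\leftarrow i]=[y\leftarrow i']:(E@[x\leftarrow i])$. Sizes: $|v|=0$, $|tu|=|t|+|u|+1$, $|(t,\epsilon)|=|t|$, $|(t,E@[x\leftarrow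 i])|=|(t,E)|+|i|$. Multi types: linear types $L ::= M\multimap N$; multi types $M,N ::= [L_1,\dots,L_n]$ (finite multisets, $n\ge 0$); $\mathbf 0$ is the empty multiset, $\uplus$ multiset sum. Type context $\Gamma$: total map from variables to multi types with finite $\mathrm{dom}(\Gamma)=\{x\mid \Gamma(x)\ne\mathbf 0\}$; $(\Gamma\uplus\Delta)(x)=\Gamma(x)\uplus\Delta(x)$; $x:M$ maps $x$ to $M$ and all else to $\mathbf 0$; $\Gamma,x:M$ extends $\Gamma$ ($x\notin\mathrm{dom}(\Gamma)$) by $x\mapsto M$. Typing rules: (ax) $x:M\vdash x:M$; (@) from $\Gamma\vdash t:[M\multimap N]$ and $\Delta\vdash u:M$ infer $\Gamma\uplus\Delta\vdash tu:N$; ($\lambda$) from $\Gamma_k,x:M_k\vdash t:N_k$ for $k=1,\dots,n$ ($n\ge0$) infer $\Gamma_1\uplus\dots\uplus\Gamma_n\vdash\lambda x.t:[M_1\multimap N_1,\dots,M_n\multimap N_n]$; (es$_\epsilon$) from $\Gamma\vdash t:M$ infer $\Gamma\vdash (t,\epsilon):M$; (es$_@$) from $\Gamma,x:M\vdash(t,E):N$ and $\Delta\vdash i:M$ infer $\Gamma\uplus\Delta\vdash(t,E@[x\leftarrow i]):N$. $|\pi|$ is the number of (@) rules in $\pi$. Type sizes: $|M\multimap N|=1+|M|+|N|$, $|[L_1,\dots,L_n]|=\sum_k|L_k|$, $|\Gamma|=\sum_x|\Gamma(x)|$. Inert multi types: finite multisets of linear types $\mathbf 0\multimap N$ with $N$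 inert (inductively; $\mathbf 0$ is inert); a context is inert if all its values are inert. A derivation $\pi\triangleright\Gamma\vdash e:M$ is inert if $\Gamma$ and $M$ are inert, and tight if it is inert and $M=\mathbf 0$. *)

(* Defs.v *)
(* Mathematical Components, with finmap for finite multisets and finitely     *)
(* supported maps.                                                            *)
From HB Require Import structures.
From mathcomp Require Import all_boot.
From mathcomp Require Import finmap multiset.

Set Implicit Arguments.
Unset Strict Implicit.
Unset Printing Implicit Defensive.

Local Open Scope mset_scope.
Local Open Scope fset_scope.
Local Open Scope nat_scope.

(* ------------------------------------------------------------------------ *)
(* Terms                                                                    *)
(* ------------------------------------------------------------------------ *)

(* De Bruijn indices, so that alpha-equivalence is equality. *)
Inductive term : Type :=
| Var of nat
| Lam of term
| App of term & term.

(* [lift c t] increments the indices >= c, making room for a fresh variable c. *)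
Fixpoint lift (c : nat) (t : term) : term :=
  match t with
  | Var x => Var (bump c x)
  | Lam t => Lam (lift c.+1 t)
  | App t u => App (lift c t) (lift c u)
  end.

(* [subst c u t] replaces the variable c by u and removes c from the scope. *)
Fixpoint subst (c : nat) (u t : term) : term :=
  match t with
  | Var x => if x == c then u else Var (unbump c x)
  | Lam t => Lam (subst c.+1 (lift 0 u) t)
  | App t1 t2 => App (subst c u t1) (subst c u t2)
  end.

Definition is_var (t : term) : bool := if t is Var _ then true else false.

Definition is_value (t : term) : bool := if t is App _ _ then false else true.

(* f ::= v | i  and  i ::= x f1 ... fn (n > 0); the spine of i is read from   *)
(* its last argument, i.e. i ::= x f | i f.  See is_inertP.                   *)
Fixpoint is_inert (t : term) : bool :=
  if t is App u f then
    (is_var u || is_inert u) && (is_value f || is_inert f)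
  else false.

Definition is_fireball (t : term) : bool := is_value t || is_inert t.

Lemma is_inertP t :
  reflect (exists x fs, [/\ fs <> [::], all is_fireball fs
                          & t = foldl App (Var x) fs])
          (is_inert t).
Proof.
apply: (iffP idP).
- elim: t => // u IHu f _ /= /andP[/orP[|/IHu]].
  + by case: u {IHu} => // x _ ff; exists x, [:: f]; rewrite /= andbT.
  + move=> [x [fs [_ afs ->]]] ff; exists x, (rcons fs f).
    by rewrite all_rcons foldl_rcons afs /is_fireball ff; split => //; case: fs {afs}.
- move=> [x [fs [fs0 + ->]]].
  elim/last_ind: fs fs0 => // fs f IH _.
  rewrite all_rcons foldl_rcons => /andP[ff afs] /=; rewrite andbC.
  apply/andP; split; first exact: ff.
  by case: fs IH afs => [|g fs] IH afs //=; rewrite [is_inert _]IH ?orbT.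
Qed.

Record inert_term : Type :=
  InertTerm { inert_val :> term; inert_valP : is_inert inert_val }.

HB.instance Definition _ := [isSub for inert_val].

Fixpoint tsize (t : term) : nat :=
  if t is App t u then tsize t + tsize u + 1 else 0.

(* ------------------------------------------------------------------------ *)
(* The split fireball calculus                                              *)
(* ------------------------------------------------------------------------ *)

Inductive ectx : Type :=
| Hole
| CAppR of term & ectx
| CAppL of ectx & term.

Fixpoint right_ectx (C : ectx) : bool :=
  match C with
  | Hole => true
  | CAppR _ C => right_ectx C
  | CAppL C f => right_ectx C && is_fireball f
  end.

Fixpoint plug (C : ectx) (t : term) : term :=
  match C with
  | Hole => t
  | CAppR u C => App u (plug C t)
  | CAppL C u => App (plug C t) u
  end.

(* The hole of an evaluation context is never under a binder. *)
Fixpoint lift_ectx (C : ectx) : ectx :=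
  match C with
  | Hole => Hole
  | CAppR u C => CAppR (lift 0 u) (lift_ectx C)
  | CAppL C u => CAppL (lift_ectx C) (lift 0 u)
  end.

(* In (t, [x <- i] : E) the variable x is bound in t only, while the          *)
(* variables bound by E may occur in both t and i.  Hence in (t, E) the index *)
(* k < size E, in t, is the variable bound by the k-th entry of E; in the     *)
(* k-th entry of E, the index j denotes the variable bound by the             *)
(* (k + 1 + j)-th entry.  Indices pointing past the end of E are free.        *)
Definition env : Type := seq inert_term.
Definition program : Type := (term * env)%type.

Definition coerced_value (p : program) : Prop :=
  exists2 v, is_value v & p = (v, [::]).

Definition psize (p : program) : nat := tsize p.1 + \sum_(i <- p.2) tsize i.

Lemma psize_nil t : psize (t, [::]) = tsize t.
Proof. by rewrite /psize big_nil addn0. Qed.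

Lemma psize_rcons t (E : env) i : psize (t, rcons E i) = psize (t, E) + tsize i.
Proof. by rewrite /psize -cats1 big_cat big_seq1 addnA. Qed.

Inductive beta_v : program -> program -> Prop :=
| BetaV C t v (E : env) : right_ectx C -> is_value v ->
    beta_v (plug C (App (Lam t) v), E) (plug C (subst 0 v t), E).

(* The index 0 of the body of the abstraction becomes the variable bound by   *)
(* the new entry; lifting C makes that variable fresh for C.                  *)
Inductive beta_i : program -> program -> Prop :=
| BetaI C t (i : inert_term) (E : env) : right_ectx C ->
    beta_i (plug C (App (Lam t) i), E) (plug (lift_ectx C) t, i :: E).

Definition beta_f (p q : program) : Prop := beta_v p q \/ beta_i p q.

Definition normal (p : program) : Prop := forall q, ~ beta_f p q.

Inductive eval : program -> program -> Type :=
| EvalNil p : eval p p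
| EvalCons p q r : beta_f p q -> eval q r -> eval p r.

Fixpoint eval_length p q (d : eval p q) : nat :=
  match d with
  | EvalNil _ => 0
  | EvalCons _ _ _ _ d => (eval_length d).+1
  end.

(* ------------------------------------------------------------------------ *)
(* Linear and multi types                                                   *)
(* ------------------------------------------------------------------------ *)

(* Linear types are the least solution of  L ~ {mset L} * {mset L}.  Since a  *)
(* finite multiset over a type requires a choiceType structure on it, they    *)
(* are carved out of the type of raw types, in which lists stand for          *)
(* multisets, by requiring every list to be the canonical enumeration of the  *)
(* multiset of its elements.  The facts arrow_inj, arrow_surj and ltype_ind   *)
(* characterize the result up to isomorphism.                                 *)
Inductive rawtype : Type := RawArrow of seq rawtype & seq rawtype.

Fixpoint raw_nest_ind (P : rawtype -> Prop)
    (H : forall s1 s2, foldr (fun r => and (P r)) True s1 ->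
                       foldr (fun r => and (P r)) True s2 -> P (RawArrow s1 s2))
    (r : rawtype) : P r :=
  let fix aux (s : seq rawtype) : foldr (fun r => and (P r)) True s :=
    match s with
    | [::] => I
    | r :: s => conj (raw_nest_ind H r) (aux s)
    end in
  let: RawArrow s1 s2 := r in H s1 s2 (aux s1) (aux s2).

Fixpoint raw_code (r : rawtype) : GenTree.tree void :=
  let: RawArrow s1 s2 := r in
  GenTree.Node 0 [:: GenTree.Node 0 (map raw_code s1);
                     GenTree.Node 0 (map raw_code s2)].

Fixpoint raw_decode (g : GenTree.tree void) : rawtype :=
  match g with
  | GenTree.Node _ [:: GenTree.Node _ g1; GenTree.Node _ g2] =>
      RawArrow (map raw_decode g1) (map raw_decode g2)
  | _ => RawArrow [::] [::]
  end.

Lemma raw_codeK : cancel raw_code raw_decode.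
Proof.
elim/raw_nest_ind => s1 s2 IH1 IH2 /=; congr RawArrow.
- by elim: s1 IH1 => //= r s IHs [-> /IHs ->].
- by elim: s2 IH2 => //= r s IHs [-> /IHs ->].
Qed.

HB.instance Definition _ := Countable.copy rawtype (can_type raw_codeK).

Definition canon (s : seq rawtype) : seq rawtype := enum_mset (seq_mset s).

Fixpoint raw_canonical (r : rawtype) : bool :=
  let: RawArrow s1 s2 := r in
  [&& all raw_canonical s1, all raw_canonical s2, canon s1 == s1
    & canon s2 == s2].

Record ltype : Type :=
  LType { ltype_raw : rawtype; ltype_rawP : raw_canonical ltype_raw }.

HB.instance Definition _ := [isSub for ltype_raw].
HB.instance Definition _ := [Countable of ltype by <:].

Definition mtype : Type := {mset ltype}.

Lemma canon_idem s : canon (canon s) = canon s.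
Proof. by rewrite /canon seq_mset_id. Qed.

Lemma all_canon (P : pred rawtype) s : all P (canon s) = all P s.
Proof. exact/perm_all/perm_eq_seq_mset. Qed.

Lemma all_raw_canonical (s : seq ltype) :
  all raw_canonical (canon (map ltype_raw s)).
Proof. by rewrite all_canon; apply/allP => _ /mapP[L _ ->]; apply: ltype_rawP. Qed.

Lemma arrow_subproof (M N : mtype) :
  raw_canonical (RawArrow (canon (map ltype_raw (enum_mset M)))
                          (canon (map ltype_raw (enum_mset N)))).
Proof. by rewrite /= !all_raw_canonical !canon_idem !eqxx. Qed.

Definition arrow (M N : mtype) : ltype := LType (arrow_subproof M N).

Notation "M ⊸ N" := (arrow M N) (at level 55, right associativity).

Lemma canon_map_inj (M N : mtype) :
  canon (map ltype_raw (enum_mset M)) = canon (map ltype_raw (enum_mset N)) ->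
  M = N.
Proof.
move=> /(congr1 (fun s => seq_mset s)); rewrite /canon !seq_mset_id => /eq_seq_msetP.
by move=> /(perm_map_inj val_inj)/eq_seq_msetP; rewrite !seq_mset_id.
Qed.

Lemma arrow_inj M N M' N' : M ⊸ N = M' ⊸ N' -> M = M' /\ N = N'.
Proof. by move=> [/canon_map_inj -> /canon_map_inj ->]. Qed.

Lemma canon_surj s : all raw_canonical s -> canon s == s ->
  exists M : mtype, canon (map ltype_raw (enum_mset M)) = s.
Proof.
move=> cs /eqP def_s.
exists (seq_mset (pmap (insub : rawtype -> option ltype) s)).
rewrite -[RHS]def_s; congr enum_mset; apply/eq_seq_msetP.
rewrite (perm_trans (perm_map _ (perm_eq_seq_mset _))) //.
by rewrite (pmap_filter (insubK ltype)) (eq_in_filter (a2 := predT)) ?filter_predT //;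
  move=> r /(allP cs) cr; rewrite /= insubT.
Qed.

Lemma arrow_surj L : exists M N, L = M ⊸ N.
Proof.
case: L => -[s1 s2] cL; have := cL => /= /and4P[c1 c2 e1 e2].
have [M eM] := canon_surj c1 e1; have [N eN] := canon_surj c2 e2.
by exists M, N; apply: val_inj; rewrite /= eM eN.
Qed.

Fixpoint rsize (r : rawtype) : nat :=
  let: RawArrow s1 s2 := r in
  1 + sumn (map rsize s1) + sumn (map rsize s2).

Definition lsize (L : ltype) : nat := rsize (ltype_raw L).

Definition msize (M : mtype) : nat := \sum_(L <- enum_mset M) lsize L.

Lemma lsize_arrow M N : lsize (M ⊸ N) = 1 + msize M + msize N.
Proof.
have E (P : mtype) : sumn (map rsize (canon (map ltype_raw (enum_mset P)))) = msize P.
  rewrite sumnE big_map (perm_big _ (perm_eq_seq_mset _)) /=.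
  by rewrite big_map; apply: eq_bigr.
by rewrite /lsize /= !E.
Qed.

Lemma lsize_mem (M : mtype) L : L \in M -> lsize L <= msize M.
Proof.
by move=> LM; rewrite /msize (big_rem L LM) leq_addr.
Qed.

Lemma ltype_ind (P : ltype -> Prop) :
  (forall M N : mtype, (forall L, L \in M -> P L) -> (forall L, L \in N -> P L) ->
     P (M ⊸ N)) ->
  forall L, P L.
Proof.
move=> H L; have [n] := ubnP (lsize L); elim: n L => // n IH L.
have [M [N ->]] := arrow_surj L; rewrite lsize_arrow ltnS => le_n.
by apply: H => L' /lsize_mem le_L'; apply: IH; apply: leq_trans le_n;
  rewrite add1n addSn ltnS (leq_trans le_L') ?leq_addr ?leq_addl.
Qed.

Inductive inert_ltype : ltype -> Prop :=
| InertArrow (N : mtype) : inert_mtype N -> inert_ltype (mset0 ⊸ N)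
with inert_mtype : mtype -> Prop :=
| InertMset (M : mtype) : (forall L, L \in M -> inert_ltype L) -> inert_mtype M.

(* ------------------------------------------------------------------------ *)
(* Type contexts                                                            *)
(* ------------------------------------------------------------------------ *)

(* Total maps from variables to multi types; dom Γ is finsupp Γ. *)
Definition tctx : Type := {fsfun nat -> mtype with mset0}.

Definition tctx0 : tctx := [fsfun].

Definition tctxD (Γ Δ : tctx) : tctx :=
  [fsfun x in finsupp Γ `|` finsupp Δ => Γ x `+` Δ x].

Definition tctx1 (x : nat) (M : mtype) : tctx := [fsfun tctx0 with x |-> M].

(* Γ, x : M where x is the variable with index 0 in the extended scope. *)
Definition tctx_cons (M : mtype) (Γ : tctx) : tctx :=
  [fsfun x in 0 |` [fset y.+1 | y in finsupp Γ] =>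
     if x is y.+1 then Γ y else M].

Lemma tctx0E x : tctx0 x = mset0.
Proof. by rewrite fsfunE. Qed.

Lemma tctxDE Γ Δ x : tctxD Γ Δ x = Γ x `+` Δ x.
Proof.
rewrite fsfunE inE; case: finsuppP => [|//] _ /=.
by case: finsuppP => // _; rewrite mset0D.
Qed.

Lemma tctx1E x M y : tctx1 x M y = if y == x then M else mset0.
Proof. by rewrite fsfun_withE tctx0E. Qed.

Lemma tctx_consE M Γ x : tctx_cons M Γ x = if x is y.+1 then Γ y else M.
Proof.
rewrite fsfunE !inE; case: x => [|y] //=.
case: ifP => // /negbT; apply: contraNeq => Γy.
by apply/imfsetP; exists y => //=; rewrite mem_finsupp eq_sym.
Qed.

Lemma tctxDA : associative tctxD.
Proof. by move=> Γ Δ Θ; apply/fsfunP => x; rewrite !tctxDE msetDA. Qed.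

Lemma tctxDC : commutative tctxD.
Proof. by move=> Γ Δ; apply/fsfunP => x; rewrite !tctxDE msetDC. Qed.

Lemma tctx0D : left_id tctx0 tctxD.
Proof. by move=> Γ; apply/fsfunP => x; rewrite tctxDE tctx0E mset0D. Qed.

HB.instance Definition _ :=
  Monoid.isComLaw.Build tctx tctx0 tctxD tctxDA tctxDC tctx0D.

Definition csize (Γ : tctx) : nat := \sum_(x <- finsupp Γ) msize (Γ x).

Definition inert_tctx (Γ : tctx) : Prop := forall x, inert_mtype (Γ x).

(* ------------------------------------------------------------------------ *)
(* Type derivations                                                         *)
(* ------------------------------------------------------------------------ *)

Inductive tder : tctx -> term -> mtype -> Type :=
| TAx x M : tder (tctx1 x M) (Var x) M
| TApp Γ Δ t u M N :
    tder Γ t [mset M ⊸ N] -> tder Δ u M -> tder (tctxD Γ Δ) (App t u) N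
| TLam n (Γ : 'I_n -> tctx) (M N : 'I_n -> mtype) t :
    (forall k, tder (tctx_cons (M k) (Γ k)) t (N k)) ->
    tder (\big[tctxD/tctx0]_(k < n) Γ k) (Lam t)
         (seq_mset [seq M k ⊸ N k | k : 'I_n]).

(* The appended entry is the outermost binder of the program, so the variable *)
(* it binds has index 0 in the type context of (t, E).                        *)
Inductive pder : tctx -> program -> mtype -> Type :=
| PNil Γ t M : tder Γ t M -> pder Γ (t, [::]) M
| PSnoc Γ Δ t (E : env) (i : inert_term) M N :
    pder (tctx_cons M Γ) (t, E) N -> tder Δ i M ->
    pder (tctxD Γ Δ) (t, rcons E i) N.

Fixpoint tder_size Γ t M (π : tder Γ t M) : nat :=
  match π with
  | TAx _ _ => 0
  | TApp _ _ _ _ _ _ π1 π2 => tder_size π1 + tder_size π2 + 1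
  | TLam n _ _ _ _ π => \sum_(k < n) tder_size (π k)
  end.

Fixpoint pder_size Γ p M (π : pder Γ p M) : nat :=
  match π with
  | PNil _ _ _ π => tder_size π
  | PSnoc _ _ _ _ _ _ _ π1 π2 => pder_size π1 + tder_size π2
  end.

Definition inert_pder Γ p M (π : pder Γ p M) : Prop :=
  inert_tctx Γ /\ inert_mtype M.

Definition tight_pder Γ p M (π : pder Γ p M) : Prop :=
  inert_pder π /\ M = mset0.

(* Main.v *)
Require Import Defs.
From mathcomp Require Import all_boot.
From mathcomp Require Import finmap multiset.

Set Implicit Arguments.
Unset Strict Implicit.
Unset Printing Implicit Defensive.

Local Open Scope mset_scope.
Local Open Scope fset_scope.
Local Open Scope nat_scope.

(* Going backwards along the evaluation, every step adds exactly one          *)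
(* application rule to the derivation and preserves its context and type      *)
(* (subject expansion): the hole of an evaluation context is typed exactly    *)
(* once, and the derivations of the copies of a substituted value merge into  *)
(* a single one without changing their total size. It remains to type normal  *)
(* programs tightly. There the term is a fireball: a value gets the type 0    *)
(* with no application rule, and an inert term can be given any inert type M, *)
(* in an inert context of size |i| + |M|; each environment entry is then      *)
(* typed with the type that the context assigns to its variable.              *)

(** The two expansion steps are [ptyped_beta_v] and [ptyped_beta_i], iterated by [ptyped_eval]; the
    normal case is [tight_program]. For a normal program, number of rules, size and context size
    agree because each application outside abstractions costs one application rule and one arrow in
    the type of a head variable: a spine is typed with [mset0 ⊸ N] at each argument, and every
    argument with [mset0]. Typing an environment entry moves the arrows of its variable to the head
    of the entry, so none is lost. For a coerced value the context has size 0, and it is empty since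
    every linear type has positive size. *)

Definition tctx_del (c : nat) (Γ : tctx) : tctx :=
  [fsfun x in [fset unbump c y | y in finsupp Γ] => Γ (bump c x)].

Lemma tctx_delE c Γ x : tctx_del c Γ x = Γ (bump c x).
Proof.
rewrite fsfunE; case: ifP => // /negbT; apply: contraNeq => Γx.
by apply/imfsetP; exists (bump c x); [rewrite /= mem_finsupp eq_sym | rewrite bumpK].
Qed.

Lemma tctx_delD c Γ Δ :
  tctx_del c (tctxD Γ Δ) = tctxD (tctx_del c Γ) (tctx_del c Δ).
Proof. by apply/fsfunP => x; rewrite tctxDE !tctx_delE tctxDE. Qed.

Lemma tctx_del0 c : tctx_del c tctx0 = tctx0.
Proof. by apply/fsfunP => x; rewrite tctx_delE !tctx0E. Qed.

Lemma tctx_del1_bump c x M : tctx_del c (tctx1 (bump c x) M) = tctx1 x M.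
Proof.
by apply/fsfunP => y; rewrite tctx_delE !tctx1E (inj_eq (can_inj (bumpK c))).
Qed.

Lemma tctx_del1_eq c M : tctx_del c (tctx1 c M) = tctx0.
Proof.
apply/fsfunP => y; rewrite tctx_delE tctx1E tctx0E; case: eqP => // e.
by have := neq_bump c y; rewrite e eqxx.
Qed.

Lemma tctx_del_cons c M Γ :
  tctx_del c.+1 (tctx_cons M Γ) = tctx_cons M (tctx_del c Γ).
Proof.
apply/fsfunP => -[|x]; rewrite tctx_delE !tctx_consE // bumpS.
by rewrite tctx_delE.
Qed.

Lemma tctx_delK M Γ : tctx_del 0 (tctx_cons M Γ) = Γ.
Proof. by apply/fsfunP => x; rewrite tctx_delE tctx_consE. Qed.

(** Splits any context at index 0, which gives it the shape that the rules for abstractions and for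
    environment entries ask of their premises. *)
Lemma tctx_consK (Γ : tctx) : tctx_cons (Γ 0) (tctx_del 0 Γ) = Γ.
Proof. by apply/fsfunP => -[|x]; rewrite tctx_consE ?tctx_delE. Qed.

Lemma tctx1_mset0 x : tctx1 x mset0 = tctx0.
Proof. by apply/fsfunP => y; rewrite tctx1E tctx0E; case: ifP. Qed.

Lemma tctx1D x M N : tctxD (tctx1 x M) (tctx1 x N) = tctx1 x (M `+` N).
Proof.
by apply/fsfunP => y; rewrite tctxDE !tctx1E; case: ifP => // _; rewrite mset0D.
Qed.

Lemma tctxD0 Γ : tctxD Γ tctx0 = Γ.
Proof. by rewrite tctxDC tctx0D. Qed.

Lemma tctxDACA Γ1 Γ2 Γ3 Γ4 :
  tctxD (tctxD Γ1 Γ2) (tctxD Γ3 Γ4) = tctxD (tctxD Γ1 Γ3) (tctxD Γ2 Γ4).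
Proof. by apply/fsfunP => x; rewrite !tctxDE msetDACA. Qed.

Lemma tctxDAC Γ Δ Θ : tctxD (tctxD Γ Δ) Θ = tctxD (tctxD Γ Θ) Δ.
Proof. by rewrite -!tctxDA (tctxDC Δ). Qed.

Lemma seq_mset_cons (T : choiceType) (a : T) s : seq_mset (a :: s) = a +` seq_mset s.
Proof. by apply/msetP => b; rewrite mset1DE !mset_seqE /= eq_sym. Qed.

Lemma seq_mset_nil (T : choiceType) : seq_mset [::] = mset0 :> {mset T}.
Proof. by apply/msetP => b; rewrite mset_seqE mset0E. Qed.

(** * Typing with a size: construction and inversion *)

(** Forgetting the derivation but keeping its size allows rewriting with equations between contexts,
    types and sizes. *)
Definition typed (n : nat) Γ t M : Prop :=
  exists π : tder Γ t M, tder_size π = n.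

Lemma typed_var x M : typed 0 (tctx1 x M) (Var x) M.
Proof. by exists (TAx x M). Qed.

Lemma typed_app n1 n2 Γ Δ t u M N :
  typed n1 Γ t [mset M ⊸ N] -> typed n2 Δ u M ->
  typed (n1 + n2).+1 (tctxD Γ Δ) (App t u) N.
Proof. by move=> [π1 <-] [π2 <-]; exists (TApp π1 π2); rewrite /= addn1. Qed.

Lemma typed_var_inv n Γ x M : typed n Γ (Var x) M -> n = 0 /\ Γ = tctx1 x M.
Proof.
(* The match on the subject inside the statement leaves all indices of the derivation free, so that
   plain case analysis applies. *)
suff H Δ t N (π : tder Δ t N) :
    if t is Var y then tder_size π = 0 /\ Δ = tctx1 y N else True.
  by move=> [π <-]; apply: (H _ _ _ π).
by case: π.
Qed.

Lemma typed_app_inv n Γ t u N : typed n Γ (App t u) N ->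
  exists n1 n2 Γ1 Γ2 M, [/\ typed n1 Γ1 t [mset M ⊸ N], typed n2 Γ2 u M,
    Γ = tctxD Γ1 Γ2 & n = (n1 + n2).+1].
Proof.
suff H Δ e P (π : tder Δ e P) :
    if e is App t u then exists n1 n2 Γ1 Γ2 M,
      [/\ typed n1 Γ1 t [mset M ⊸ P], typed n2 Γ2 u M,
        Δ = tctxD Γ1 Γ2 & tder_size π = (n1 + n2).+1] else True.
  by move=> [π <-]; apply: (H _ _ _ π).
case: π => // {Γ t u N}Γ {}Δ t u M N π1 π2.
exists (tder_size π1), (tder_size π2), Γ, Δ, M.
by split; rewrite /= ?addn1 //; [exists π1 | exists π2].
Qed.

Lemma typed_lam_inv n Γ t M : typed n Γ (Lam t) M ->
  exists k (m : 'I_k -> nat) (Γs : 'I_k -> tctx) (Ms Ns : 'I_k -> mtype),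
  [/\ forall i, typed (m i) (tctx_cons (Ms i) (Γs i)) t (Ns i),
      n = \sum_i m i, Γ = \big[tctxD/tctx0]_i Γs i
    & M = seq_mset [seq Ms i ⊸ Ns i | i : 'I_k]].
Proof.
suff H Δ e P (π : tder Δ e P) :
    if e is Lam t then
      exists k (m : 'I_k -> nat) (Γs : 'I_k -> tctx) (Ms Ns : 'I_k -> mtype),
      [/\ forall i, typed (m i) (tctx_cons (Ms i) (Γs i)) t (Ns i),
          tder_size π = \sum_i m i, Δ = \big[tctxD/tctx0]_i Γs i
        & P = seq_mset [seq Ms i ⊸ Ns i | i : 'I_k]] else True.
  by move=> [π <-]; apply: (H _ _ _ π).
case: π => // k Γs Ms Ns u π.
by exists k, (fun i => tder_size (π i)), Γs, Ms, Ns; split=> // i; exists (π i).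
Qed.

Lemma typed_lam k (m : 'I_k -> nat) (Γs : 'I_k -> tctx) (Ms Ns : 'I_k -> mtype) t :
  (forall i, typed (m i) (tctx_cons (Ms i) (Γs i)) t (Ns i)) ->
  typed (\sum_i m i) (\big[tctxD/tctx0]_i Γs i) (Lam t)
        (seq_mset [seq Ms i ⊸ Ns i | i : 'I_k]).
Proof.
move=> /fin_all_exists[π sz]; exists (TLam π) => /=.
exact: eq_bigr.
Qed.

Lemma image_ord_recl (T : Type) k (f : 'I_k.+1 -> T) :
  [seq f i | i : 'I_k.+1] = f ord0 :: [seq f (lift ord0 i) | i : 'I_k].
Proof. by rewrite /image_mem enum_ordSl /= -map_comp. Qed.

Lemma image_ord0 (T : Type) (f : 'I_0 -> T) : [seq f i | i : 'I_0] = [::].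
Proof. by apply: size0nil; rewrite size_image card_ord. Qed.

Lemma typed_lam0 t : typed 0 tctx0 (Lam t) mset0.
Proof.
have := @typed_lam 0 (fun=> 0) (fun=> tctx0) (fun=> mset0) (fun=> mset0) t.
rewrite !big_ord0 image_ord0 seq_mset_nil; apply.
by case.
Qed.

(** With [typed_lam0], this builds the n-ary rule one premise at a time. *)
Lemma typed_lamS m n Γ Δ t M N P :
  typed m (tctx_cons M Γ) t N -> typed n Δ (Lam t) P ->
  typed (m + n) (tctxD Γ Δ) (Lam t) ((M ⊸ N) +` P).
Proof.
move=> tt /typed_lam_inv[k [ms [Γs [Ms [Ns [ts -> -> ->]]]]]].
pose cons T (a : T) (f : 'I_k -> T) i := if unlift ord0 i is Some j then f j else a.
have cons0 T (a : T) f : cons T a f ord0 = a by rewrite /cons unlift_none.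
have consS T (a : T) f j : cons T a f (lift ord0 j) = f j by rewrite /cons liftK.
have := @typed_lam _ (cons _ m ms) (cons _ Γ Γs) (cons _ M Ms) (cons _ N Ns) t.
rewrite !big_ord_recl image_ord_recl seq_mset_cons !cons0.
under [in X in typed (m + X)]eq_bigr do rewrite consS.
under [in X in tctxD Γ X]eq_bigr do rewrite consS.
rewrite (eq_image (frefl _) (fun i => congr2 arrow (consS _ M Ms i) (consS _ N Ns i))).
by apply=> i; case: (unliftP ord0 i) => [j|] ->; rewrite ?cons0 ?consS.
Qed.

(* Presents the n-ary rule for abstractions as a list of unary premises. *)
Lemma typed_lam_ind t (P : nat -> tctx -> mtype -> Prop) :
  P 0 tctx0 mset0 ->
  (forall m n Γ Δ M N Q, typed m (tctx_cons M Γ) t N -> P n Δ Q ->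
     P (m + n) (tctxD Γ Δ) ((M ⊸ N) +` Q)) ->
  forall n Γ M, typed n Γ (Lam t) M -> P n Γ M.
Proof.
move=> P0 PS n Γ M /typed_lam_inv[k [ms [Γs [Ms [Ns [ts -> -> ->]]]]]].
elim: k => [|k IH] in ms Γs Ms Ns ts *.
  by rewrite !big_ord0 image_ord0 seq_mset_nil.
rewrite !big_ord_recl image_ord_recl seq_mset_cons; apply: PS (ts _) _.
exact: IH.
Qed.

Lemma typed_lam1 n Γ t M N : typed n (tctx_cons M Γ) t N ->
  typed n Γ (Lam t) [mset M ⊸ N].
Proof.
by move=> /typed_lamS/(_ (typed_lam0 t)); rewrite addn0 tctxD0 msetD0.
Qed.

(** * Values and anti-substitution *)

Lemma typed_value0 v : is_value v -> typed 0 tctx0 v mset0.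
Proof.
case: v => // [x|t] _; last exact: typed_lam0.
by rewrite -(tctx1_mset0 x); apply: typed_var.
Qed.

(** Axioms on the same variable add up, and the premises of two abstraction rules can be
    concatenated; neither rule counts in the size. *)
Lemma typed_valueD m n Γ Δ v M N : is_value v ->
  typed m Γ v M -> typed n Δ v N -> typed (m + n) (tctxD Γ Δ) v (M `+` N).
Proof.
case: v => // [x|t] _.
  move=> /typed_var_inv[-> ->] /typed_var_inv[-> ->]; rewrite tctx1D.
  exact: typed_var.
move=> tM tN; elim/typed_lam_ind: m Γ M / tM => [|m1 m2 Γ1 Γ2 P Q R tP IH].
  by rewrite tctx0D mset0D.
by rewrite -addnA -tctxDA -msetDA; apply: typed_lamS.
Qed.

Lemma typed_lift_inv c n Γ t M : typed n Γ (Defs.lift c t) M ->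
  Γ c = mset0 /\ typed n (tctx_del c Γ) t M.
Proof.
elim: t => [x|t IH|t IHt u IHu] /= in c n Γ M *.
- move=> /typed_var_inv[-> ->]; rewrite tctx1E (negPf (neq_bump _ _)).
  by rewrite tctx_del1_bump; split=> //; apply: typed_var.
- move=> tt; elim/typed_lam_ind: n Γ M / tt => [|m n Γ Δ P Q R tP [Δ0 tR]].
    by rewrite tctx0E tctx_del0; split=> //; apply: typed_lam0.
  have [Γ0 tt] := IH _ _ _ _ tP.
  rewrite tctx_consE in Γ0; rewrite tctx_del_cons in tt.
  by rewrite tctxDE Γ0 Δ0 msetD0 tctx_delD; split=> //; apply: typed_lamS.
- move=> /typed_app_inv[n1 [n2 [Γ1 [Γ2 [P [/IHt[e1 t1] /IHu[e2 t2] -> ->]]]]]].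
  by rewrite tctxDE e1 e2 msetD0 tctx_delD; split=> //; apply: typed_app t1 t2.
Qed.

Lemma is_value_lift c v : is_value (Defs.lift c v) = is_value v.
Proof. by case: v. Qed.

(** Each copy of [v] is replaced by an axiom of the same type. These types add up to [Γ1 c], and the
    derivations of the copies merge by [typed_valueD]; without any copy, [typed_value0] supplies the
    derivation. *)
Lemma typed_subst_inv c n Γ t v M : is_value v -> typed n Γ (subst c v t) M ->
  exists n1 n2 Γ1 Γ2, [/\ typed n1 Γ1 t M, typed n2 Γ2 v (Γ1 c),
    Γ = tctxD (tctx_del c Γ1) Γ2 & n = n1 + n2].
Proof.
elim: t => [x|t IH|t IHt u IHu] /= in c v n Γ M * => vv.
- case: eqP => [->|/eqP x_c] tv.
    exists 0, n, (tctx1 c M), Γ; rewrite tctx1E eqxx tctx_del1_eq tctx0D.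
    by split=> //; apply: typed_var.
  have ex : x = bump c (unbump c x) by rewrite unbumpKcond (negPf x_c).
  move: (unbump c x) ex tv => y -> /typed_var_inv[-> ->] {x x_c}.
  exists 0, 0, (tctx1 (bump c y) M), tctx0.
  rewrite tctx1E (negPf (neq_bump _ _)) tctxD0 tctx_del1_bump.
  by split; [apply: typed_var | apply: typed_value0 | |].
- move=> tt; elim/typed_lam_ind: n Γ M / tt => [|m n Γ Δ P Q R tP].
    exists 0, 0, tctx0, tctx0; rewrite tctx_del0 tctxD0 tctx0E.
    by split=> //; [apply: typed_lam0 | apply: typed_value0].
  move=> [n1 [n2 [Δ1 [Δ2 [tn1 tn2 -> ->]]]]].
  have [|m1 [m2 [Γ1 [Γ2 [tm1 tm2 eΓ ->]]]]] := IH _ _ _ _ _ _ tP.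
    by rewrite is_value_lift.
  have [Γ20 tm2'] := typed_lift_inv tm2.
  (* The lifted value does not mention the bound variable, so the type of that variable comes
     entirely from the body. *)
  have Γ10 : Γ1 0 = P.
    move/fsfunP/(_ 0): eΓ; rewrite tctx_consE tctxDE tctx_delE Γ20 msetD0.
    by move->.
  rewrite -[Γ1]tctx_consK Γ10 in tm1 eΓ.
  exists (m1 + n1), (m2 + n2), (tctxD (tctx_del 0 Γ1) Δ1).
  exists (tctxD (tctx_del 0 Γ2) Δ2); split.
  + exact: typed_lamS tm1 tn1.
  + by rewrite tctxDE tctx_delE; apply: typed_valueD.
  + rewrite tctx_delD tctxDACA; congr tctxD.
    by rewrite -[Γ](tctx_delK P) eΓ tctx_delD tctx_del_cons tctx_delK.
  + by rewrite addnACA.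
- move=> /typed_app_inv[n1 [n2 [Γ1 [Γ2 [P [t1 t2 -> ->]]]]]].
  have [m1 [m2 [Δ1 [Δ2 [tm1 tm2 -> ->]]]]] := IHt _ _ _ _ _ vv t1.
  have [p1 [p2 [Θ1 [Θ2 [tp1 tp2 -> ->]]]]] := IHu _ _ _ _ _ vv t2.
  exists (m1 + p1).+1, (m2 + p2), (tctxD Δ1 Θ1), (tctxD Δ2 Θ2); split.
  + exact: typed_app tm1 tp1.
  + by rewrite tctxDE; apply: typed_valueD.
  + by rewrite tctx_delD tctxDACA.
  + by rewrite addSn addnACA.
Qed.

Lemma typed_beta_v n Γ t v M : is_value v -> typed n Γ (subst 0 v t) M ->
  typed n.+1 Γ (App (Lam t) v) M.
Proof.
move=> vv /(typed_subst_inv vv)[n1 [n2 [Γ1 [Γ2 [t1 t2 -> ->]]]]].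
by rewrite -[Γ1]tctx_consK in t1; apply: typed_app (typed_lam1 t1) t2.
Qed.

(** * Subject expansion *)

(** No evaluation context enters an abstraction, whose body could be typed any number of times;
    hence [k] is added exactly once. *)
Lemma typed_plug C k t u :
  (forall n Γ M, typed n Γ t M -> typed (k + n) Γ u M) ->
  forall n Γ M, typed n Γ (plug C t) M -> typed (k + n) Γ (plug C u) M.
Proof.
move=> tu; elim: C => [|s C IH|C IH s] n Γ M //=; first exact: tu.
- move=> /typed_app_inv[n1 [n2 [Γ1 [Γ2 [P [t1 t2 -> ->]]]]]].
  by rewrite addnS addnCA; apply: typed_app t1 (IH _ _ _ t2).
- move=> /typed_app_inv[n1 [n2 [Γ1 [Γ2 [P [t1 t2 -> ->]]]]]].
  by rewrite addnS addnA; apply: typed_app (IH _ _ _ t1) t2.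
Qed.

(* Since the lifted context does not mention the variable 0, its whole type   *)
(* [Γ 0] is needed by t, and hence is the type to be given to the argument.   *)
Lemma typed_beta_i C m n Γ Δ t u M :
  typed n Γ (plug (lift_ectx C) t) M -> typed m Δ u (Γ 0) ->
  typed (n + m).+1 (tctxD (tctx_del 0 Γ) Δ) (plug C (App (Lam t) u)) M.
Proof.
elim: C => [|s C IH|C IH s] /= in n Γ M *.
- by rewrite -{1}[Γ]tctx_consK => tt; apply: typed_app; apply: typed_lam1.
- move=> /typed_app_inv[n1 [n2 [Γ1 [Γ2 [P [/typed_lift_inv[e1 t1] t2 -> ->]]]]]].
  rewrite tctxDE e1 mset0D tctx_delD -tctxDA addSn -addnA -addnS => tu.
  exact: typed_app t1 (IH _ _ _ t2 tu).
- move=> /typed_app_inv[n1 [n2 [Γ1 [Γ2 [P [t1 /typed_lift_inv[e2 t2] -> ->]]]]]].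
  rewrite tctxDE e2 msetD0 tctx_delD tctxDAC addSn addnAC -addSn => tu.
  exact: typed_app (IH _ _ _ t1 tu) t2.
Qed.

Definition ptyped n Γ p M := exists π : pder Γ p M, pder_size π = n.

Lemma ptyped_nil n Γ t M : typed n Γ t M -> ptyped n Γ (t, [::]) M.
Proof. by move=> [π <-]; exists (PNil π). Qed.

Lemma ptyped_rcons m n Γ Δ t (E : env) (i : inert_term) M N :
  ptyped m (tctx_cons M Γ) (t, E) N -> typed n Δ i M ->
  ptyped (m + n) (tctxD Γ Δ) (t, rcons E i) N.
Proof. by move=> [π1 <-] [π2 <-]; exists (PSnoc π1 π2). Qed.

Lemma ptyped_inv n Γ p N : ptyped n Γ p N ->
  (p.2 = [::] /\ typed n Γ p.1 N) \/
  exists m1 m2 Γ1 Γ2 (E : env) (i : inert_term) M,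
  [/\ p.2 = rcons E i, ptyped m1 (tctx_cons M Γ1) (p.1, E) N, typed m2 Γ2 i M,
    Γ = tctxD Γ1 Γ2 & n = m1 + m2].
Proof.
move=> [π <-]; case: π => {Γ p N} [Γ t M π|Γ Δ t E i M N π1 π2] /=.
  by left; split=> //; exists π.
right; exists (pder_size π1), (tder_size π2), Γ, Δ, E, i, M.
by split=> //; [exists π1 | exists π2].
Qed.

Lemma ptyped_nil_inv n Γ t N : ptyped n Γ (t, [::]) N -> typed n Γ t N.
Proof.
move=> /ptyped_inv[[]//|[? [? [? [? [E [i [? [/=]]]]]]]]].
by move/(congr1 size); rewrite size_rcons.
Qed.

Lemma ptyped_rcons_inv n Γ t (E : env) (i : inert_term) N :
  ptyped n Γ (t, rcons E i) N ->
  exists m1 m2 Γ1 Γ2 M,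
  [/\ ptyped m1 (tctx_cons M Γ1) (t, E) N, typed m2 Γ2 i M,
    Γ = tctxD Γ1 Γ2 & n = m1 + m2].
Proof.
move=> /ptyped_inv[[/= /(congr1 size)]|]; first by rewrite size_rcons.
move=> [m1 [m2 [Γ1 [Γ2 [E' [i' [M [/= /rcons_inj[-> ->] *]]]]]]]].
by exists m1, m2, Γ1, Γ2, M.
Qed.

Lemma ptyped_beta_v n Γ p q M : beta_v p q -> ptyped n Γ q M ->
  ptyped n.+1 Γ p M.
Proof.
move=> pq; case: q / pq => C t v E _ vv.
(* The typing rule peels off the last entry, whereas reduction adds entries at the front. *)
elim/last_ind: E => [|E i IH] in n Γ *.
  move/ptyped_nil_inv => tq; apply: ptyped_nil; apply: (typed_plug (k := 1)) tq.
  by move=> *; apply: typed_beta_v.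
move=> /ptyped_rcons_inv[m1 [m2 [Γ1 [Γ2 [P [t1 t2 -> ->]]]]]].
by rewrite -addSn; apply: ptyped_rcons (IH _ _ t1) t2.
Qed.

Lemma ptyped_beta_i n Γ p q M : beta_i p q -> ptyped n Γ q M ->
  ptyped n.+1 Γ p M.
Proof.
move=> pq; case: q / pq => C t i E _.
elim/last_ind: E => [|E j IH] in n Γ *.
  (* The new entry is here also the last one, so its derivation becomes that of the argument of the
     redex. *)
  move=> /(@ptyped_rcons_inv _ _ _ [::])[m1 [m2 [Γ1 [Γ2 [P [t1 t2 -> ->]]]]]].
  apply: ptyped_nil; rewrite -[Γ1](tctx_delK P).
  by apply: typed_beta_i (ptyped_nil_inv t1) _; rewrite tctx_consE.
rewrite -rcons_cons => /ptyped_rcons_inv[m1 [m2 [Γ1 [Γ2 [P [t1 t2 -> ->]]]]]].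
by rewrite -addSn; apply: ptyped_rcons (IH _ _ t1) t2.
Qed.

Lemma ptyped_eval p q (d : eval p q) n Γ M : ptyped n Γ q M ->
  ptyped (eval_length d + n) Γ p M.
Proof.
elim: d => //= {}p {}q r pq d IH /IH tq; rewrite addSn.
by case: pq => [/ptyped_beta_v|/ptyped_beta_i]; apply.
Qed.

(** * Normal programs *)

Lemma progress t : ~~ is_fireball t ->
  exists C u f, [/\ right_ectx C, is_fireball f & t = plug C (App (Lam u) f)].
Proof.
elim: t => // t IHt u IHu.
(* Evaluation goes from right to left: the function may be reduced only once its argument is a
   fireball. *)
case fu: (is_fireball u); last first.
  by have [C [s [f [? ? ->]]]] := IHu (negbT fu); exists (CAppR t C), s, f.
case ft: (is_fireball t); last first.
  have [C [s [f [? ? ->]]]] := IHt (negbT ft).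
  by exists (CAppL C u), s, f; split=> //=; apply/andP.
case: t ft {IHt} => [x|s|s1 s2] ft; rewrite /is_fireball /=.
- by rewrite -/(is_fireball u) fu.
- by move=> _; exists Hole, s, u.
- by rewrite -/(is_fireball u) fu andbT; move: ft; rewrite /is_fireball /= => ->.
Qed.

Lemma normal_fireball t (E : env) : normal (t, E) -> is_fireball t.
Proof.
move=> nt; apply/negP => /negP/progress[C [u [f [rC]]]].
case/orP=> [vf et|i_f et]; [apply: (nt (plug C (subst 0 f u), E))|].
  by left; rewrite et; apply: BetaV.
apply: (nt (plug (lift_ectx C) u, InertTerm i_f :: E)).
by right; rewrite et; apply: (BetaI u (InertTerm i_f)).
Qed.

(** * Sizes of multi types and contexts *)

Lemma msize0 : msize mset0 = 0.
Proof. by rewrite /msize big_mset0. Qed.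

Lemma msizeD M N : msize (M `+` N) = msize M + msize N.
Proof.
rewrite /msize -big_cat; apply: perm_big; rewrite perm_sym.
apply/eq_seq_msetP/msetP => a; rewrite !mset_seqE count_cat.
by rewrite !count_mem_mset msetE2.
Qed.

Lemma msize1 L : msize [mset L] = lsize L.
Proof. by rewrite /msize enum_msetn big_seq1. Qed.

Lemma msize_eq0 M : msize M = 0 -> M = mset0.
Proof.
move=> M0; apply/msetP => L; apply/eqP; rewrite mset0E mset_eq0; apply/negP.
move=> /lsize_mem; rewrite M0.
by have [P [Q ->]] := arrow_surj L; rewrite lsize_arrow.
Qed.

(** A common initial segment as index set makes sizes of contexts with different supports
    comparable. *)
Lemma csize_widen (Γ : tctx) n : (forall x, n <= x -> Γ x = mset0) ->
  csize Γ = \sum_(x < n) msize (Γ x).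
Proof.
move=> Γn; rewrite -(big_mkord xpredT (fun x => msize (Γ x))).
rewrite (bigID (fun x => x \in finsupp Γ)) /= [X in _ + X]big1 ?addn0; last first.
  by move=> x; rewrite memNfinsupp => /eqP->; apply: msize0.
rewrite -big_filter; apply/perm_big/uniq_perm; rewrite ?filter_uniq ?iota_uniq //.
move=> x; rewrite mem_filter mem_index_iota andbC leq0n /=.
case: (ltnP x n) => // /Γn Γx; apply/negP.
by rewrite mem_finsupp Γx eqxx.
Qed.

Lemma tctx_bounded (Γ : tctx) : exists n, forall x, n <= x -> Γ x = mset0.
Proof.
exists (\max_(x <- finsupp Γ) x).+1 => x; case: finsuppP => // xΓ.
by rewrite ltnNge (leq_bigmax_seq (F := id)).
Qed.

Lemma csize0 : csize tctx0 = 0.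
Proof. by rewrite /csize finsupp0 big_seq_fset0. Qed.

Lemma csizeD Γ Δ : csize (tctxD Γ Δ) = csize Γ + csize Δ.
Proof.
have [[m Γm] [n Δn]] := (tctx_bounded Γ, tctx_bounded Δ).
have Γk x : maxn m n <= x -> Γ x = mset0 by rewrite geq_max => /andP[/Γm].
have Δk x : maxn m n <= x -> Δ x = mset0 by rewrite geq_max => /andP[_ /Δn].
rewrite (csize_widen Γk) (csize_widen Δk) (@csize_widen _ (maxn m n)).
  by rewrite -big_split; apply: eq_bigr => x _; rewrite tctxDE msizeD.
by move=> x kx; rewrite tctxDE Γk ?Δk ?mset0D.
Qed.

Lemma csize_cons M Γ : csize (tctx_cons M Γ) = msize M + csize Γ.
Proof.
have [n Γn] := tctx_bounded Γ; rewrite (csize_widen Γn) (@csize_widen _ n.+1).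
  rewrite big_ord_recl tctx_consE; congr addn.
  by apply: eq_bigr => x _; rewrite tctx_consE.
by case=> // x nx; rewrite tctx_consE Γn.
Qed.

Lemma csize1 x M : csize (tctx1 x M) = msize M.
Proof.
rewrite (@csize_widen _ x.+1) => [|y]; last by rewrite tctx1E; case: ltngtP.
rewrite big_ord_recr /= big1 ?tctx1E ?eqxx // => y _.
by rewrite tctx1E ltn_eqF ?msize0.
Qed.

Lemma csize_eq0 Γ : csize Γ = 0 -> finsupp Γ = fset0.
Proof.
move=> Γ0; apply/fsetP => x; rewrite mem_finsupp in_fset0; apply/eqP.
apply: msize_eq0; have [n Γn] := tctx_bounded Γ.
case: (leqP n x) => [/Γn->|xn]; first exact: msize0.
move/eqP: Γ0; rewrite (csize_widen Γn) sum_nat_eq0.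
by move=> /forallP/(_ (Ordinal xn))/eqP.
Qed.

(** * Tight typing of normal programs *)

Lemma inert_mset0 : inert_mtype mset0.
Proof. by constructor=> L; rewrite in_mset0. Qed.

Lemma inert_arrow1 M : inert_mtype M -> inert_mtype [mset mset0 ⊸ M].
Proof. by move=> iM; constructor=> L; rewrite in_mset1 => /eqP->; constructor. Qed.

Lemma inert_msetD M N : inert_mtype M -> inert_mtype N -> inert_mtype (M `+` N).
Proof.
by move=> [{}M iM] [{}N iN]; constructor=> L /msetDP[/iM|/iN].
Qed.

Lemma inert_tctxD Γ Δ : inert_tctx Γ -> inert_tctx Δ -> inert_tctx (tctxD Γ Δ).
Proof. by move=> iΓ iΔ x; rewrite tctxDE; apply: inert_msetD. Qed.

Lemma inert_tctx0 : inert_tctx tctx0.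
Proof. by move=> x; rewrite tctx0E; apply: inert_mset0. Qed.

Lemma inert_tctx1 x M : inert_mtype M -> inert_tctx (tctx1 x M).
Proof. by move=> iM y; rewrite tctx1E; case: ifP => // _; apply: inert_mset0. Qed.

(** Variables are included so that the induction can descend the spine to its head. The type is
    arbitrary because it grows along the spine and, for an environment entry, is dictated by the
    rest of the program. *)
Lemma tight_inert t M : is_var t || is_inert t -> inert_mtype M ->
  exists Γ, [/\ typed (Defs.tsize t) Γ t M, inert_tctx Γ
               & csize Γ = Defs.tsize t + msize M].
Proof.
elim: t M => // [x|t IHt u IHu] M.
  move=> _ iM; exists (tctx1 x M); rewrite csize1.
  by split; [apply: typed_var | apply: inert_tctx1 |].
move=> /= /andP[it fu] iM.
(* The extra arrow accounts for this application in the size of the context. *)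
have [Γ [tt iΓ sΓ]] := IHt _ it (inert_arrow1 iM).
have [Δ [tu iΔ sΔ]] : exists Δ, [/\ typed (Defs.tsize u) Δ u mset0, inert_tctx Δ
                                  & csize Δ = Defs.tsize u].
  case/orP: fu => [vu|iu]; last first.
    have [|Δ [tu iΔ sΔ]] := IHu _ _ inert_mset0; first by rewrite iu orbT.
    by exists Δ; rewrite sΔ msize0 addn0.
  have -> : Defs.tsize u = 0 by case: u vu {IHu}.
  by exists tctx0; rewrite csize0; split=> //; [apply: typed_value0 | apply: inert_tctx0].
exists (tctxD Γ Δ); rewrite addn1; split.
- exact: typed_app tt tu.
- exact: inert_tctxD.
- by rewrite csizeD sΓ sΔ msize1 lsize_arrow msize0 addn0 add1n addnS addSn addnAC.
Qed.

Lemma tight_fireball f : is_fireball f ->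
  exists Γ, [/\ typed (Defs.tsize f) Γ f mset0, inert_tctx Γ & csize Γ = Defs.tsize f].
Proof.
case/orP=> [vf|i_f]; last first.
  have [|Γ [tf iΓ sΓ]] := @tight_inert f _ _ inert_mset0; first by rewrite i_f orbT.
  by exists Γ; rewrite sΓ msize0 addn0.
have -> : Defs.tsize f = 0 by case: f vf.
by exists tctx0; rewrite csize0; split=> //; [apply: typed_value0 | apply: inert_tctx0].
Qed.

Lemma tight_program f (E : env) : is_fireball f ->
  exists Γ, [/\ ptyped (psize (f, E)) Γ (f, E) mset0, inert_tctx Γ
               & csize Γ = psize (f, E)].
Proof.
move=> ff; elim/last_ind: E => [|E i [Γ [tf iΓ sΓ]]].
  have [Γ [tf iΓ sΓ]] := tight_fireball ff.
  by exists Γ; rewrite psize_nil; split=> //; apply: ptyped_nil.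
have [|Δ [ti iΔ sΔ]] := @tight_inert i _ _ (iΓ 0); first by rewrite inert_valP orbT.
exists (tctxD (tctx_del 0 Γ) Δ); rewrite psize_rcons; split.
- by apply: ptyped_rcons ti; rewrite tctx_consK.
- by apply: inert_tctxD => // x; rewrite tctx_delE.
(* The context loses [Γ 0] and gains the size of [i] plus that of [Γ 0]: a net growth by the size of
   [i]. *)
- have := csize_cons (Γ 0) (tctx_del 0 Γ); rewrite tctx_consK sΓ => ->.
  by rewrite csizeD sΔ addnA addnC addnA.
Qed.

Theorem theorem5 (p q : program) (d : eval p q) (hq : normal q) :
  exists (Γ : tctx) (π : pder Γ p mset0),
    [/\ tight_pder π,
        pder_size π = eval_length d + psize q,
        eval_length d + psize q = eval_length d + csize Γ
      & coerced_value q ->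
          pder_size π = eval_length d /\ finsupp Γ = fset0].
Proof.
have [Γ [tq iΓ sΓ]] : exists Γ, [/\ ptyped (psize q) Γ q mset0, inert_tctx Γ
                                   & csize Γ = psize q].
  by case: q hq {d} => f E /normal_fireball; apply: tight_program.
have [π sπ] := ptyped_eval d tq; exists Γ, π; split=> //.
- by split=> //; split=> //; apply: inert_mset0.
- by rewrite sΓ.
- case=> v vv eq; have q0 : psize q = 0 by rewrite eq psize_nil; case: v vv {eq}.
  by split; [rewrite sπ q0 addn0 | apply: csize_eq0; rewrite sΓ].
Qed.
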